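(* Let $(X,d)$ be a compact metric space, let $m\ge2$, and let $\mathcal S=(X^m,(\phi_j)_{j\in\{1,\dots,n\}})$ be a generalized iterated function system consisting of Lipschitz contractions, with attractor $A_{\mathcal S}$. Let $(\beta_k)_{k\ge1}$ and $(\sigma_k)_{k\ge1}$ be sequences of positive reals converging to $0$, and let $B_0\subset X$ be a nonempty finite set. Suppose that the sets $B_k\in\mathcal K^*(X)$, $k\ge1$, are produced by the following procedure: for each $k\ge1$, choose a nonempty finite set $B_{k-1}^{\beta_k}\subset X$ with $h(B_{k-1},B_{k-1}^{\beta_k})<\beta_k$; let $\mathcal R_{k-1}^{\beta_k}:=\mathcal R_{B_{k-1}^{\beta_k}}$ be the (finite) iterated function system induced by $B_{k-1}^{\beta_k}$ with respect to $\mathcal S$; and choose $B_k\in\mathcal K^*(X)$ with $h(B_k,A_{\mathcal R_{k-1}^{\beta_k}})<\sigma_k$, where $A_{\mathcal R_{k-1}^{\beta_k}}$ is the attractor of $\mathcal R_{k-1}^{\beta_k}$. Then $B_k\to A_{\mathcal S}$ as $k\to\infty$ with respect to $h$.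
   Context: $\mathcal K^*(X)$ is the set of nonempty compact subsets of $X$ with the Hausdorff-Pompeiu metric $h$. $X^m$ carries the maximum metric; a map $\phi:X^m\to X$ is a Lipschitz contraction if its Lipschitz constant with respect to that metric is $<1$. A generalized iterated function system (GIFS) of order $m$ is a finite family of Lipschitz maps $\phi_j:X^m\to X$, $j=1,\dots,n$. If the $\phi_j$ are Lipschitz contractions, it is known that there is a unique $A_{\mathcal S}\in\mathcal K^*(X)$ with $\bigcup_{j=1}^n\phi_j(A_{\mathcal S}\times\cdots\times A_{\mathcal S})=A_{\mathcal S}$; it is the attractor of $\mathcal S$. For $B\in\mathcal K^*(X)$, the iterated function system induced by $B$ with respect to $\mathcal S$ is $\mathcal R_B=(X,(\psi_\theta)_{\theta\in\Theta})$ with $\Theta=B^{m-1}\times\{1,\dots,n\}$ and $\psi_\theta(x)=\phi_j(x,b_2,\dots,b_m)$ for $\theta=(b_2,\dots,b_m,j)$. Its attractor $A_{\mathcal R_B}$ is the unique set $A\in\mathcal K^*(X)$ with $A=\overline{\bigcup_{\theta\in\Theta}\psi_\theta(A)}$. *)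

(* Defs.v *)
From HB Require Import structures.
From mathcomp Require Export all_boot all_order all_algebra.
From mathcomp Require Export all_classical all_reals all_analysis.

Set Implicit Arguments.
Unset Strict Implicit.
Unset Printing Implicit Defensive.

Export Order.TTheory GRing.Theory Num.Theory numFieldNormedType.Exports.

Local Open Scope classical_set_scope.
Local Open Scope ring_scope.

Section Hausdorff.
Context {R : realType} {X : metricType R}.
Implicit Types A B : set X.

(* K^*(X) *)
Definition nonempty_compact A : Prop := A !=set0 /\ compact A.

Definition dist_to (x : X) B : R := inf [set mdist x b | b in B].

Definition excess A B : R := sup [set dist_to a B | a in A].

(* [sup] and [inf] return 0 when they do not exist, so this is the
   Hausdorff-Pompeiu metric only between nonempty bounded sets. *)
Definition hausdorff_dist A B : R := Num.max (excess A B) (excess B A).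

End Hausdorff.

Section IFS.
Context {R : realType} {X : metricType R}.

Definition max_dist (m : nat) (x y : 'I_m -> X) : R :=
  \big[Num.max/0]_(i < m) mdist (x i) (y i).

Definition lipschitz_contraction (m : nat) (f : ('I_m -> X) -> X) : Prop :=
  exists q : R, 0 <= q < 1 /\
    forall x y : 'I_m -> X, mdist (f x) (f y) <= q * max_dist x y.

(* A ^ m *)
Definition set_power (m : nat) (A : set X) : set ('I_m -> X) :=
  [set x | forall i, A (x i)].

Definition gifs_attractor (m n : nat) (phi : 'I_n -> ('I_m -> X) -> X)
    (A : set X) : Prop :=
  nonempty_compact A /\ \bigcup_(j : 'I_n) (phi j @` set_power A) = A.

Definition ifs_attractor (I : Type) (Theta : set I) (psi : I -> X -> X)
    (A : set X) : Prop :=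
  nonempty_compact A /\ A = closure (\bigcup_(t in Theta) (psi t @` A)).

(* (x, b_2, ..., b_m), for an order m written as a successor *)
Definition prepend (m : nat) (x : X) (b : 'I_m -> X) : 'I_m.+1 -> X :=
  fun i => oapp b x (unlift ord0 i).

Definition induced_index (m n : nat) (B : set X) : set (('I_m -> X) * 'I_n) :=
  set_power B `*` [set: 'I_n].

Definition induced_map (m n : nat) (phi : 'I_n -> ('I_m.+1 -> X) -> X)
    (t : ('I_m -> X) * 'I_n) (x : X) : X :=
  phi t.2 (prepend x t.1).

Definition induced_ifs_attractor (m n : nat)
    (phi : 'I_n -> ('I_m.+1 -> X) -> X) (B : set X) (A : set X) : Prop :=
  ifs_attractor (induced_index B) (induced_map phi) A.

End IFS.

(* Main.v *)
Require Import Defs.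
From mathcomp Require Import lra.

Set Implicit Arguments.
Unset Strict Implicit.

Local Open Scope classical_set_scope.
Local Open Scope ring_scope.

(** Write [h] for the Hausdorff-Pompeiu distance and let [q < 1] be a common
    Lipschitz constant of the finitely many maps [phi j].  The proof rests on
    the estimate [h(A_(R_B), A_S) <= q * h(B, A_S)]
    ([induced_attractor_contracts]).  Its reason: both attractors are unions
    of images of boxes [P_1 x ... x P_m] under the [phi j].  For [A_S] every
    factor is [A_S]; for the induced system the first factor is [A_(R_B)] and
    the others are [B], up to a closure.  Since the [phi j] contract the
    maximum metric by [q], the distance [E] of the two attractors obeys
    [E <= q * max(E, h(B, A_S))], and the alternative [E <= q * E] only leaves
    [E <= 0].

    The triangle inequality then turns the procedure into the recursion
    [u_(k+1) <= q * u_k + (q * beta_(k+1) + sigma_(k+1))] for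
    [u_k = h(B_k, A_S)], and a contractive recursion with vanishing
    perturbation tends to [0] ([perturbed_contraction_cvg0]).

    Suprema of infima are awkward to compose, so all distance estimates are
    carried out with the relation [approx A B r], which says that the excess of
    [A] over [B] is at most [r]; a compact space is bounded, which is what
    makes the two notions agree ([excess_leP]). *)

(** * Sequences *)

(** The geometric decay of the initial value beats any [e], and the
    perturbations, once below [(1 - q) * e], contribute at most
    [(1 - q) * e * (1 + q + q ^+ 2 + ...) = e]. *)
Lemma perturbed_contraction_cvg0 (R : realType) (q : R) (u v : nat -> R) :
  0 <= q < 1 -> (forall k, 0 <= u k) ->
  (forall k, u k.+1 <= q * u k + v k) ->
  v k @[k --> \oo] --> (0 : R) -> u k @[k --> \oo] --> (0 : R).
Proof.
move=> /andP[q0 q1] u0 uS v_cvg; apply/cvgr0Pnorm_le => e e0.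
have e20 : 0 < e / 2 by rewrite divr_gt0.
have [N _ vN] : \forall k \near \oo, `|v k| <= (1 - q) * (e / 2).
  by apply: (cvgr0Pnorm_le v).1 => //; rewrite mulr_gt0 // subr_gt0.
have decay k : u (k + N)%N <= q ^+ k * u N + e / 2.
  elim: k => [|k IH]; first by rewrite expr0 mul1r lerDl ltW.
  have vk : v (k + N)%N <= (1 - q) * (e / 2).
    by apply: le_trans (ler_norm _) _; apply: vN; rewrite /= leq_addl.
  apply: le_trans (uS _) _; rewrite exprS -mulrA.
  have := ler_wpM2l q0 IH; lra.
have [M _ qM] : \forall k \near \oo, `|q ^+ k * u N| <= e / 2.
  apply: (cvgr0Pnorm_le (fun k => q ^+ k * u N)).1 => //.
  rewrite -(mul0r (u N)); apply: cvgMr_tmp.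
  by apply: cvg_expr; rewrite ger0_norm.
exists (M + N)%N => // k /= MNk; rewrite ger0_norm //.
have /subnK kE : (N <= k)%N by apply: leq_trans MNk; apply: leq_addl.
rewrite -kE (splitr e); apply: le_trans (decay _) _; rewrite lerD2r.
apply: le_trans (ler_norm _) _; apply: qM.
by rewrite /= -(leq_add2r N) kE.
Qed.

(** * Approximate inclusion and the Hausdorff-Pompeiu distance *)

Section Approximation.
Context {R : realType} {X : metricType R}.
Implicit Types (A B C : set X) (r s : R).

(** The slack [e] stands for the infimum in [dist_to], which need not be
    attained. *)
Definition approx A B r : Prop :=
  forall e, 0 < e -> forall a, A a -> exists2 b, B b & mdist a b <= r + e.

Lemma approx_le A B r s : r <= s -> approx A B r -> approx A B s.
Proof.
move=> rs AB e e0 a /(AB e e0)[b Bb ab]; exists b => //.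
by apply: le_trans ab _; rewrite lerD2r.
Qed.

Lemma approx_ge0 A B r : A !=set0 -> approx A B r -> 0 <= r.
Proof.
move=> [a Aa] AB; apply/ler_addgt0Pr => e e0.
by have [b _] := AB e e0 a Aa; apply: le_trans; apply: mdist_ge0.
Qed.

Lemma approx_trans A B C r s :
  approx A B r -> approx B C s -> approx A C (r + s).
Proof.
move=> AB BC e e0 a Aa; have e20 : 0 < e / 2 by rewrite divr_gt0.
have [b Bb ab] := AB _ e20 a Aa; have [c Cc bc] := BC _ e20 b Bb.
exists c => //; apply: le_trans (metric_triangle a b c) _.
by rewrite (splitr e) addrACA lerD.
Qed.

Lemma approx_subset A B r : 0 <= r -> A `<=` B -> approx A B r.
Proof.
by move=> r0 AB e e0 a /AB Ba; exists a => //; rewrite mdistxx addr_ge0 // ltW.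
Qed.

Lemma approx_closure A : approx (closure A) A 0.
Proof.
move=> e e0 a /(_ _ (nbhsx_ballx a e e0))[b [Ab]].
by rewrite ballEmdist add0r => /ltW; exists b.
Qed.

(** Near every point the distance to a fixed point is bounded, and compactness
    makes the bound uniform. *)
Lemma compact_mdist_bounded :
  compact [set: X] -> exists M : R, forall x y : X, mdist x y <= M.
Proof.
have [[p _]|X0 _] := pselect ([set: X] !=set0); last first.
  by exists 0 => x; exfalso; apply: X0; exists x.
move=> /compact_near_coveringP cptX.
have [N _ XN] : \forall k \near \oo,
    [set: X] `<=` (fun k x => mdist p x <= k%:R) k.
  apply: cptX => x _; exists (ball x 1, [set k | mdist p x + 1 <= k%:R]).
    by split; [apply: nbhsx_ballx | apply: nbhs_infty_ger].
  move=> [y k] /= []; rewrite ballEmdist /= => xy; apply: le_trans.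
  by apply: le_trans (metric_triangle p x y) _; rewrite lerD2l ltW.
have pN x : mdist p x <= N%:R by apply: (XN N) => //=.
exists (N%:R + N%:R) => x y; apply: le_trans (metric_triangle x p y) _.
by rewrite metric_sym lerD.
Qed.

(** Boundedness is needed because [excess] is [0] when the supremum does not
    exist. *)
Lemma excess_leP (M : R) A B r : (forall x y : X, mdist x y <= M) ->
  A !=set0 -> B !=set0 -> excess A B <= r <-> approx A B r.
Proof.
move=> XM A0 [b0 Bb0].
have lbB a : has_lbound [set mdist a b | b in B].
  by exists 0 => _ [b _ <-]; apply: mdist_ge0.
have neB a : [set mdist a b | b in B] !=set0 by exists (mdist a b0), b0.
have dist_leP a s :
    dist_to a B <= s <-> forall e, 0 < e -> exists2 b, B b & mdist a b <= s + e.
  split=> [as_ e e0|as_].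
    have [_ [b Bb <-] ab] := inf_adherent e0 (conj (neB a) (lbB a)).
    by exists b => //; apply: le_trans (ltW ab) _; rewrite lerD2r.
  apply/ler_addgt0Pr => e e0; have [b Bb] := as_ e e0; apply: le_trans.
  by apply: ge_inf => //; exists b.
split=> [Er e e0 a Aa|AB].
  apply: (dist_leP a r).1 => //; apply: le_trans Er; apply: ub_le_sup; last first.
    by exists a.
  exists M => _ [x _ <-]; apply: le_trans (XM x b0).
  by apply: ge_inf => //; exists b0.
apply: ge_sup; first by case: A0 => a Aa; exists (dist_to a B), a.
by move=> _ [a Aa <-]; apply/dist_leP => e e0; apply: AB.
Qed.

Lemma hausdorff_leP (M : R) A B r : (forall x y : X, mdist x y <= M) ->
  A !=set0 -> B !=set0 ->
  hausdorff_dist A B <= r <-> approx A B r /\ approx B A r.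
Proof.
move=> XM A0 B0; rewrite /hausdorff_dist ge_max.
split=> [/andP[]|[AB BA]].
  by move=> /(excess_leP _ XM A0 B0) AB /(excess_leP _ XM B0 A0) BA.
by apply/andP; split; apply/(excess_leP _ XM).
Qed.

Lemma hausdorff_triangle (M : R) A B C : (forall x y : X, mdist x y <= M) ->
  A !=set0 -> B !=set0 -> C !=set0 ->
  hausdorff_dist A C <= hausdorff_dist A B + hausdorff_dist B C.
Proof.
move=> XM A0 B0 C0; apply/(hausdorff_leP _ XM) => //.
have [AB BA] := (hausdorff_leP _ XM A0 B0).1 (lexx _).
have [BC CB] := (hausdorff_leP _ XM B0 C0).1 (lexx _).
by split; [apply: approx_trans BC | rewrite addrC; apply: approx_trans BA].
Qed.

Lemma hausdorff_sym A B : hausdorff_dist A B = hausdorff_dist B A.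
Proof. by rewrite /hausdorff_dist maxC. Qed.

(** * Contractions acting on boxes *)

Lemma common_contraction_ratio (m n : nat) (phi : 'I_n -> ('I_m -> X) -> X) :
  (forall j, lipschitz_contraction (phi j)) ->
  exists q : R, 0 <= q < 1 /\
    forall j x y, mdist (phi j x) (phi j y) <= q * max_dist x y.
Proof.
move=> /fin_all_exists[q qP]; exists (\big[Num.max/0]_j q j); split.
  apply/andP; split; first exact: bigmax_ge_id.
  by apply: bigmax_lt => // j _; have [/andP[]] := qP j.
move=> j x y; apply: le_trans ((qP j).2 x y) _.
by apply: ler_wpM2r; [exact: bigmax_ge_id | exact: le_bigmax].
Qed.

Definition box_image (m n : nat) (phi : 'I_n -> ('I_m -> X) -> X)
    (P : 'I_m -> set X) : set X :=
  \bigcup_(j : 'I_n) (phi j @` [set x | forall i, P i (x i)]).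

(** Coordinates can be approximated independently of each other because the
    maximum metric only sees the worst one. *)
Lemma approx_box_image (m n : nat) (phi : 'I_n -> ('I_m -> X) -> X) (q : R)
    (P Q : 'I_m -> set X) r :
  0 <= q <= 1 ->
  (forall j x y, mdist (phi j x) (phi j y) <= q * max_dist x y) ->
  0 <= r -> (forall i, approx (P i) (Q i) r) ->
  approx (box_image phi P) (box_image phi Q) (q * r).
Proof.
move=> /andP[q0 q1] phiq r0 PQ e e0 _ [j _ [x Px <-]].
have [y yP] : exists y : 'I_m -> X,
    forall i, Q i (y i) /\ mdist (x i) (y i) <= r + e.
  have near_x i : exists y, Q i y /\ mdist (x i) y <= r + e.
    by have [y Qy xy] := PQ i e e0 (x i) (Px i); exists y.
  exact: fin_all_exists near_x.
exists (phi j y); first by exists j => //; exists y => // i; case: (yP i).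
apply: le_trans (phiq j x y) _.
have xy : max_dist x y <= r + e.
  by apply: bigmax_le => [|i _]; [rewrite addr_ge0 // ltW | case: (yP i)].
apply: le_trans (ler_wpM2l q0 xy) _.
by rewrite mulrDr lerD2l ler_piMl // ltW.
Qed.

(** The factors of the box [A x B x ... x B], in the argument order of
    [prepend]. *)
Definition head_box (m : nat) (A B : set X) (i : 'I_m.+1) : set X :=
  oapp (fun=> B) A (unlift ord0 i).

(** Letting the parameters [b_2, ..., b_m] range over [B] puts the induced
    system in the same form as the generalized one, so that one estimate
    serves both. *)
Lemma induced_unionE (m n : nat) (phi : 'I_n -> ('I_m.+1 -> X) -> X) A B :
  \bigcup_(t in induced_index B) (induced_map phi t @` A) =
  box_image phi (head_box A B).
Proof.
apply/seteqP; split=> [_ [[b j] [/= Bb _] [a Aa <-]]|_ [j _ [x xP <-]]].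
  exists j => //; exists (prepend a b) => // i.
  by rewrite /head_box /prepend; case: (unlift ord0 i).
exists (fun i => x (lift ord0 i), j).
  by split=> // i; have := xP (lift ord0 i); rewrite /head_box liftK.
exists (x ord0); first by have := xP ord0; rewrite /head_box unlift_none.
rewrite /induced_map /=; congr (phi j _); apply/funext => i.
by rewrite /prepend; case: unliftP => [k|] ->.
Qed.

Lemma head_box_ind (m : nat) A B (P : set X -> Prop) :
  P A -> P B -> forall i : 'I_m.+1, P (head_box A B i).
Proof. by move=> PA PB i; rewrite /head_box; case: unlift. Qed.

(** * The attractor of the induced system *)

Lemma max_contraction_le (q E s : R) :
  0 <= q < 1 -> 0 <= s -> E <= q * Num.max E s -> E <= q * s.
Proof.
move=> /andP[q0 q1] s0; case: (leP E s) => // sE EqE.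
have : 0 < (1 - q) * E by rewrite mulr_gt0 ?subr_gt0 // (le_lt_trans s0).
lra.
Qed.

(** The Hausdorff-Pompeiu distance of the two attractors is estimated by
    itself, through their description as images of boxes; this is enough
    because [q < 1]. *)
Lemma induced_attractor_contracts (m n : nat)
    (phi : 'I_n -> ('I_m.+1 -> X) -> X) (q M : R) (B A_R A_S : set X) :
  (forall x y : X, mdist x y <= M) -> 0 <= q < 1 ->
  (forall j x y, mdist (phi j x) (phi j y) <= q * max_dist x y) ->
  gifs_attractor phi A_S -> induced_ifs_attractor phi B A_R -> B !=set0 ->
  hausdorff_dist A_R A_S <= q * hausdorff_dist B A_S.
Proof.
move=> XM q01 phiq [[S0 _] SE] [[R0 _] RE] B0.
set E := hausdorff_dist A_R A_S; set s := hausdorff_dist B A_S.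
have [RS SR] := (hausdorff_leP _ XM R0 S0).1 (lexx E).
have [BS SB] := (hausdorff_leP _ XM B0 S0).1 (lexx s).
have s0 : 0 <= s := approx_ge0 B0 BS.
apply: max_contraction_le => //; set r := Num.max E s.
have [Er sr] : E <= r /\ s <= r by rewrite /r; split; rewrite le_max lexx ?orbT.
have r0 : 0 <= r := le_trans s0 sr.
have q01' : 0 <= q <= 1 by case/andP: q01 => -> /ltW.
have AE : A_R = closure (box_image phi (head_box A_R B)).
  by rewrite -induced_unionE.
have SE' : box_image phi (fun=> A_S) = A_S by [].
apply/(hausdorff_leP _ XM) => //; split.
  rewrite {1}AE -{1}SE' -[q * r]add0r.
  apply: (approx_trans (@approx_closure _)).
  apply: approx_box_image => // i.
  by apply: (@head_box_ind _ _ _ (fun C => approx C A_S r));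
    [apply: approx_le RS | apply: approx_le BS].
rewrite {1}AE -{1}SE' -[q * r]addr0.
apply: (approx_trans _ (approx_subset (lexx 0) (@subset_closure _ _))).
apply: approx_box_image => // i.
by apply: (@head_box_ind _ _ _ (fun C => approx A_S C r));
  [apply: approx_le SR | apply: approx_le SB].
Qed.

End Approximation.

(** * Convergence of the procedure *)

Theorem theorem4p2 (R : realType) (X : metricType R)
    (X_compact : compact [set: X])
    (m n : nat) (order_ge2 : (2 <= m.+1)%N)
    (phi : 'I_n -> ('I_m.+1 -> X) -> X)
    (phi_contraction : forall j, lipschitz_contraction (phi j))
    (A_S : set X) (A_S_attractor : gifs_attractor phi A_S)
    (beta sigma : nat -> R)
    (beta_gt0 : forall k, (1 <= k)%N -> 0 < beta k)
    (sigma_gt0 : forall k, (1 <= k)%N -> 0 < sigma k)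
    (beta_cvg : beta k @[k --> \oo] --> (0 : R))
    (sigma_cvg : sigma k @[k --> \oo] --> (0 : R))
    (* [Bbeta k] is the finite set B_{k-1}^{beta_k} and [A_R k] is the
       attractor of the iterated function system it induces *)
    (B Bbeta A_R : nat -> set X)
    (B0_finite : finite_set (B 0%N)) (B0_neq0 : B 0%N !=set0)
    (B_compact : forall k, (1 <= k)%N -> nonempty_compact (B k))
    (Bbeta_finite : forall k, (1 <= k)%N -> finite_set (Bbeta k))
    (Bbeta_neq0 : forall k, (1 <= k)%N -> Bbeta k !=set0)
    (Bbeta_close : forall k, (1 <= k)%N ->
       hausdorff_dist (B k.-1) (Bbeta k) < beta k)
    (A_R_attractor : forall k, (1 <= k)%N ->
       induced_ifs_attractor phi (Bbeta k) (A_R k))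
    (B_close : forall k, (1 <= k)%N -> hausdorff_dist (B k) (A_R k) < sigma k) :
  hausdorff_dist (B k) A_S @[k --> \oo] --> (0 : R).
Proof.
have [M XM] := compact_mdist_bounded X_compact.
have [q [q01 phiq]] := common_contraction_ratio phi_contraction.
have S0 : A_S !=set0 by case: A_S_attractor => -[].
have B_neq0 k : B k !=set0 by case: k => // k; case: (B_compact k.+1).
pose v k := q * beta k.+1 + sigma k.+1.
apply: (@perturbed_contraction_cvg0 _ q _ v) => // [k|k|].
- have [BS _] := (hausdorff_leP _ XM (B_neq0 k) S0).1 (lexx _).
  exact: approx_ge0 BS.
(* The chain of distances runs from [B k.+1] through [A_R k.+1] to [A_S], and
   from [Bbeta k.+1] through [B k] to [A_S]. *)
- have AR := A_R_attractor k.+1 isT; have R0 : A_R k.+1 !=set0 by case: AR => -[].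
  have q0 : 0 <= q by case/andP: q01.
  have BAR := B_close k.+1 isT; have BB := Bbeta_close k.+1 isT.
  have := hausdorff_triangle XM (B_neq0 k.+1) R0 S0.
  have := induced_attractor_contracts XM q01 phiq A_S_attractor AR
    (Bbeta_neq0 k.+1 isT).
  have := ler_wpM2l q0
    (hausdorff_triangle XM (Bbeta_neq0 k.+1 isT) (B_neq0 k) S0).
  have := ler_wpM2l q0 (ltW BB).
  rewrite /= (hausdorff_sym (B k) (Bbeta k.+1)) mulrDr /v; lra.
- have -> : (0 : R) = q * 0 + 0 by rewrite mulr0 addr0.
  by apply: cvgD; first apply: cvgMl_tmp; rewrite cvg_shiftS.
Qed.
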